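(* Let $R$ be a commutative ring with identity such that $\mathrm{Max}(R)$ is infinite. If the intersection of each infinite family of (distinct) maximal ideals of $R$ is zero, then $R$ is not the direct sum of two of its proper ideals, i.e. there are no proper ideals $I,J$ of $R$ with $I+J=R$ and $I\cap J=\{0\}$.
   Context: $\mathrm{Max}(R)$ denotes the set of all maximal ideals of $R$. *)

(* Defs.v *)
From mathcomp Require Import all_boot all_algebra.
From mathcomp Require Import boolp classical_sets functions cardinality.

Set Implicit Arguments.
Unset Strict Implicit.
Unset Printing Implicit Defensive.

Import GRing.Theory.
Local Open Scope classical_set_scope.
Local Open Scope ring_scope.

(* The ideals of a commutative ring R are the submodules of the regular module
   R^o. The library's [idealr_closed] is not used because it has properness
   built in and excludes the zero ring. *)
Definition ideal (R : comPzRingType) (I : set R) : Prop :=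
  submod_closed ([in I] : {pred R^o}).

Definition properIdeal (R : comPzRingType) (I : set R) : Prop :=
  ideal I /\ I <> [set: R].

Definition maximalIdeal (R : comPzRingType) (M : set R) : Prop :=
  properIdeal M /\ forall J : set R, properIdeal J -> M `<=` J -> J = M.

Definition Max (R : comPzRingType) : set (set R) :=
  [set M | maximalIdeal M].
Arguments Max R : clear implicits.

Definition addIdeal (R : comPzRingType) (I J : set R) : set R :=
  [set x + y | x in I & y in J].

(* Main.v *)
Require Import Defs.
From mathcomp Require Import all_boot all_algebra.
From mathcomp Require Import boolp classical_sets functions cardinality.
From mathcomp Require Import ring.

(** Suppose [R = I + J] with [I] and [J] meeting in [0], and write [1 = a + b]
    with [a] in [I] and [b] in [J].  Then [a * b] lies in both ideals, so
    [a * b = 0], and as maximal ideals are prime ([maximalIdeal_prime]), each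
    of them contains [a] or [b].  Hence the infinite set [Max R] is the union
    of the maximal ideals through [a] and those through [b], and one of the two
    sets is infinite.  An element common to infinitely many maximal ideals is
    [0] by hypothesis, so [b = 1] or [a = 1], and [J] or [I] is the whole
    ring. *)

Import GRing.Theory.
Local Open Scope classical_set_scope.
Local Open Scope ring_scope.

Section Ideals.
Context {R : comPzRingType}.
Implicit Types (I J M : set R) (a b x y r : R).

Lemma idealP I :
  ideal I <-> I 0 /\ forall r x y, I x -> I y -> I (r * x + y).
Proof.
split=> -[I0 Ilin]; split.
- by move: I0; rewrite inE.
- move=> r x y Ix Iy; have := Ilin r x y.
  by rewrite !inE; apply.
- by rewrite inE.
- by move=> r x y; rewrite !inE; apply: Ilin.
Qed.

Lemma ideal_mulr I r x : ideal I -> I x -> I (r * x).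
Proof.
by move=> /idealP[I0 Ilin] Ix; rewrite -[r * x]addr0; apply: Ilin.
Qed.

Lemma ideal_add I x y : ideal I -> I x -> I y -> I (x + y).
Proof.
by move=> /idealP[_ Ilin] Ix Iy; rewrite -[x]mul1r; apply: Ilin.
Qed.

Lemma ideal_eqT I : ideal I -> I 1 -> I = [set: R].
Proof.
move=> idI I1; apply/seteqP; split=> // x _.
by rewrite -[x]mulr1; apply: ideal_mulr.
Qed.

Lemma ideal_add_principal M a :
  ideal M -> ideal (addIdeal M [set r * a | r in [set: R]]).
Proof.
move=> idM; apply/idealP; split.
  exists 0; first by case/idealP: idM.
  by exists (0 * a); [exists 0 | rewrite mul0r addr0].
move=> r _ _ [m Mm [_ [s _ <-] <-]] [n Mn [_ [t _ <-] <-]].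
exists (r * m + n).
  by apply: ideal_add => //; apply: ideal_mulr.
by exists ((r * s + t) * a); [exists (r * s + t) | ring].
Qed.

(** If [a] is not in [M] then maximality gives [1 = m + r * a] with [m] in [M],
    and multiplying by [b] puts [b = b * m + r * (a * b)] in [M]. *)
Lemma maximalIdeal_prime M a b :
  maximalIdeal M -> M (a * b) -> M a \/ M b.
Proof.
move=> [[idM _] maxM] Mab; have [Ma|nMa] := pselect (M a); [by left | right].
pose K := addIdeal M [set r * a | r in [set: R]].
have idK : ideal K by apply: ideal_add_principal.
have MK : M `<=` K.
  by move=> m Mm; exists m => //; exists (0 * a); [exists 0 | rewrite mul0r addr0].
have Ka : K a.
  exists 0; first by case/idealP: idM.
  by exists (1 * a); [exists 1 | rewrite mul1r add0r].
have KT : K = [set: R].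
  apply: contrapT => KnT; apply: nMa.
  by rewrite -(maxM K).
have [m Mm [_ [r _ <-] m_ra]] : K 1 by rewrite KT.
have -> : b = b * m + r * (a * b).
  by rewrite -[LHS]mulr1 -m_ra; ring.
by apply: ideal_add => //; apply: ideal_mulr.
Qed.

Lemma mem_infinite_Max_eq0 a :
  (forall F : set (set R), F `<=` Max R -> infinite_set F ->
     \bigcap_(M in F) M = [set 0]) ->
  infinite_set (Max R `&` [set M | M a]) -> a = 0.
Proof.
move=> bigcap_eq0 infF.
suff : (\bigcap_(M in Max R `&` [set M | M a]) M) a.
  by rewrite bigcap_eq0 //; apply: subIsetl.
by move=> M [].
Qed.

End Ideals.

Theorem corollary4p14 (R : comPzRingType)
    (Max_infinite : infinite_set (Max R))
    (bigcap_eq0 : forall F : set (set R), F `<=` Max R -> infinite_set F ->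
       \bigcap_(M in F) M = [set 0]) :
  ~ exists I J : set R,
      [/\ properIdeal I, properIdeal J,
          addIdeal I J = [set: R] & I `&` J = [set 0]].
Proof.
move=> [I [J [[idI InT] [idJ JnT] IJT IJ0]]].
have [a Ia [b Jb ab1]] : addIdeal I J 1 by rewrite IJT.
have ab0 : a * b = 0.
  suff : (I `&` J) (a * b) by rewrite IJ0.
  by split; [rewrite mulrC|]; apply: ideal_mulr.
have Max_cover :
    Max R `<=` (Max R `&` [set M | M a]) `|` (Max R `&` [set M | M b]).
  move=> M maxM; have idM : ideal M by case: maxM => -[].
  have Mab : M (a * b) by rewrite ab0; case/idealP: idM.
  by have [Ma|Mb] := maximalIdeal_prime M a b maxM Mab; [left | right].
have [fina|infa] := pselect (finite_set (Max R `&` [set M | M a])); last first.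
  apply: JnT; apply: ideal_eqT => //.
  by rewrite -ab1 (mem_infinite_Max_eq0 a) // add0r.
have [finb|infb] := pselect (finite_set (Max R `&` [set M | M b])); last first.
  apply: InT; apply: ideal_eqT => //.
  by rewrite -ab1 (mem_infinite_Max_eq0 b) // addr0.
by apply: Max_infinite; apply: sub_finite_set Max_cover _; rewrite finite_setU.
Qed.
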